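(* The Lorentzian sinusoidal spiral given by the pseudopolar equations $$\lambda\,\rho_+^{n}=(n+1)\sinh(n\nu_+),\qquad \lambda\,\rho_-^{n}=(n+1)\cosh(n\nu_-),\qquad n\neq 0,\ n\neq -1,$$ is the only curve (up to $\nu$-orthochrone transformations) in $\mathbb{L}^2$ with geometric angular momentum $\mathcal K(\rho)=\frac{\lambda}{n+1}\rho^{n+1}$ (and curvature $\kappa(\rho)=\lambda\,\rho^{n-1}$, $\lambda>0$), $n\neq 0$, $n\neq -1$.
   Context: $\mathbb{L}^2=(\mathbb{R}^2,g=-dx^2+dy^2)$ is the Lorentz-Minkowski plane with rectangular coordinates $(x,y)$; the curves considered are spacelike or timelike, and $n\in\mathbb{R}$. A curve $\gamma=(x,y)$ is spacelike (resp. timelike) if $g(\gamma',\gamma')>0$ (resp. $<0$) everywhere. It is unit-speed if $g(\dot\gamma,\dot\gamma)=\epsilon$ with $\epsilon=1$ (spacelike) or $\epsilon=-1$ (timelike); the dot is the derivative with respect to the arc parameter $s$. For a unit-speed curve put $T=\dot\gamma=(\dot x,\dot y)$ and $N=(\dot y,\dot x)$; the (signed) curvature $\kappa$ is defined by $\dot T=\kappa N$, i.e. $\kappa=\epsilon(\ddot x\dot y-\dot x\ddot y)$. The Lorentzian pseudodistance from the origin is $\rho=\sqrt{|g(\gamma,\gamma)|}=\sqrt{|-x^2+y^2|}$. Pseudopolar coordinates $(\rho,\nu)$, $\nu\in\mathbb{R}$, are given by $(x,y)=\pm(\rho\sinh\nu,\rho\cosh\nu)$ where $-x^2+y^2\ge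 0$ and by $(x,y)=\pm(\rho\cosh\nu,\rho\sinh\nu)$ where $-x^2+y^2\le 0$. The geometric angular momentum of a unit-speed curve written in these coordinates is $\mathcal K(s)=\rho(s)^2\,\dot\nu(s)$. In the equations of the Lorentzian sinusoidal spiral, $(\rho_+,\nu_+)$ are the pseudopolar coordinates of the spacelike curve in the form $\pm(\rho\sinh\nu,\rho\cosh\nu)$ and of the timelike curve in the form $\pm(\rho\cosh\nu,\rho\sinh\nu)$; $(\rho_-,\nu_-)$ are those of the timelike curve in the form $\pm(\rho\sinh\nu,\rho\cosh\nu)$ and of the spacelike curve in the form $\pm(\rho\cosh\nu,\rho\sinh\nu)$. The different curves obtained in this way make up what is called the Lorentzian sinusoidal spiral. For $\nu\in\mathbb{R}$, the $\nu$-orthochrone (Lorentz) transformation is $R_\nu(x,y)=(\cosh\nu\,x+\sinh\nu\,y,\ \sinh\nu\,x+\cosh\nu\,y)$.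
   Formalization: As stated the equations miss curves with this K and κ: those of plus type with ρ decreasing, and all of minus type when n < −1. The formal version replaces λ by ±λ in the equations, the sign being that of ρ′ (plus type) or of n+1 (minus type). *)

(* Defs.v *)
From Stdlib Require Import Reals.
From Coquelicot Require Import Coquelicot.
Open Scope R_scope.

Definition lorentz (u v : R * R) : R := - (fst u * fst v) + snd u * snd v.

Definition boost (a : R) (p : R * R) : R * R :=
  (cosh a * fst p + sinh a * snd p, sinh a * fst p + cosh a * snd p).

Definition in_open_interval (a b : Rbar) (s : R) : Prop := Rbar_lt a s /\ Rbar_lt s b.

Inductive causal : Set := spacelike | timelike.

Definition epsilon (c : causal) : R :=
  match c with spacelike => 1 | timelike => -1 end.

Definition is_sign (t : R) : Prop := t = 1 \/ t = -1.

(** The two forms of the pseudopolar coordinates: [sinh_cosh] is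
    [+-(rho sinh nu, rho cosh nu)], for points with [- x^2 + y^2 > 0], and
    [cosh_sinh] is [+-(rho cosh nu, rho sinh nu)], for [- x^2 + y^2 < 0].
    The sign [+-] is the argument [tau]. *)
Inductive form : Set := sinh_cosh | cosh_sinh.

Definition pseudopolar (f : form) (tau rho nu : R) : R * R :=
  match f with
  | sinh_cosh => (tau * (rho * sinh nu), tau * (rho * cosh nu))
  | cosh_sinh => (tau * (rho * cosh nu), tau * (rho * sinh nu))
  end.

Definition velocity (gamma : R -> R * R) (s : R) : R * R :=
  (Derive (fun t => fst (gamma t)) s, Derive (fun t => snd (gamma t)) s).

Definition twice_differentiable_at (u : R -> R) (s : R) : Prop :=
  ex_derive u s /\ ex_derive (Derive u) s.

Definition unit_speed (c : causal) (a b : Rbar) (gamma : R -> R * R) : Prop :=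
  forall s, in_open_interval a b s ->
    twice_differentiable_at (fun t => fst (gamma t)) s /\
    twice_differentiable_at (fun t => snd (gamma t)) s /\
    lorentz (velocity gamma s) (velocity gamma s) = epsilon c.

(** The function [kappa] with [T' = kappa N], where [T = (x', y')] and
    [N = (y', x')]. *)
Definition curvature (c : causal) (gamma : R -> R * R) (s : R) : R :=
  let T := velocity gamma in
  let T' := velocity T in
  epsilon c * (fst (T' s) * snd (T s) - fst (T s) * snd (T' s)).

(** [rho] is positive, so the curve stays off the light cone; by connectedness
    it then stays in one form, with one sign. *)
Definition pseudopolar_coordinates (f : form) (tau : R) (a b : Rbar)
    (gamma : R -> R * R) (rho nu : R -> R) : Prop :=
  forall s, in_open_interval a b s ->
    0 < rho s /\ gamma s = pseudopolar f tau (rho s) (nu s).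

Definition angular_momentum (rho nu : R -> R) (s : R) : R :=
  rho s ^ 2 * Derive nu s.

(** The subscript of [(rho_+, nu_+)] or [(rho_-, nu_-)]. *)
Inductive kind : Set := kind_plus | kind_minus.

Definition kind_of (c : causal) (f : form) : kind :=
  match c, f with
  | spacelike, sinh_cosh | timelike, cosh_sinh => kind_plus
  | timelike, sinh_cosh | spacelike, cosh_sinh => kind_minus
  end.

Definition spiral_equation (k : kind) (lambda n rho nu : R) : Prop :=
  match k with
  | kind_plus => lambda * Rpower rho n = (n + 1) * sinh (n * nu)
  | kind_minus => lambda * Rpower rho n = (n + 1) * cosh (n * nu)
  end.

Definition spiral (c : causal) (f : form) (tau lambda n : R) (p : R * R) : Prop :=
  exists rho nu, 0 < rho /\ p = pseudopolar f tau rho nu /\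
    spiral_equation (kind_of c f) lambda n rho nu.

Definition has_momentum_and_curvature (c : causal) (lambda n : R) (a b : Rbar)
    (gamma : R -> R * R) (rho nu : R -> R) : Prop :=
  forall s, in_open_interval a b s ->
    angular_momentum rho nu s = lambda / (n + 1) * Rpower (rho s) (n + 1) /\
    curvature c gamma s = lambda * Rpower (rho s) (n - 1).

(** A unit-speed curve with the momentum [lambda / (n + 1) * rho ^ (n + 1)]
    satisfies [rho' ^ 2 = 1 + (lambda / (n + 1)) ^ 2 * rho ^ (2 * n)] in the kind
    [kind_plus], so [rho] is strictly monotone, and the curve with [rho] decreasing is
    the mirror image [nu |-> - nu] of the one with [rho] increasing. Boosts only
    translate [nu], so they do not identify the two; they are the spirals with
    left-hand sides [lambda * rho ^ n] and [- lambda * rho ^ n].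
    In the kind [kind_minus] both sides of the equation have to be positive after
    division by [n + 1], which for [lambda > 0] and [n < -1] forces the
    left-hand side [- lambda * rho ^ n]. *)
Definition spiral_sign (k : kind) (n : R) (a b : Rbar) (rho : R -> R)
    (sigma : R) : Prop :=
  is_sign sigma /\
  match k with
  | kind_plus => forall s, in_open_interval a b s -> 0 < sigma * Derive rho s
  | kind_minus => 0 < sigma * (n + 1)
  end.

(* Main.v *)
(** In the null coordinates [y + x] and [y - x], the equation [T' = kappa N]
    reads [p' = kappa p], [m' = - kappa m] for the velocities [p] and [m].  With
    the given momentum, [kappa = (n + 1) nu'], so [p e^(- (n+1) nu)] and
    [m e^((n+1) nu)] are constant.  In terms of [rho] these constants are
    [(rho' + rho nu') e^(- n nu)] and [+- (rho' - rho nu') e^(n nu)]; hence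
    [rho nu' = lambda / (n + 1) rho ^ n] is a combination of [e^(n nu)] and
    [e^(- n nu)], which after a translation of [nu], i.e. a boost, is
    [+- sinh (n nu)] or [+- cosh (n nu)].  Using the curvature and not only
    [rho' ^ 2] excludes the singular solutions with [rho] constant.

    The functions [(e^t - d e^-t) / 2] and [(e^t + d e^-t) / 2] with [d = 1] or
    [d = -1] treat the causal characters and the pseudopolar forms together;
    the signs multiply under the addition formulas. *)
Require Import Defs.
From Stdlib Require Import Reals Lra Classical.
From Stdlib Require ClassicalEpsilon.
From Coquelicot Require Import Coquelicot.
Open Scope R_scope.

(** * Calculus on open intervals with possibly infinite ends *)

Lemma open_interval_locally (a b : Rbar) (s : R) :
  in_open_interval a b s -> locally s (in_open_interval a b).
Proof.
  apply (open_and (fun t : R => Rbar_lt a t) (fun t : R => Rbar_lt t b)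
           (open_Rbar_gt a) (open_Rbar_lt b)).
Qed.

Lemma open_interval_convex (a b : Rbar) (s t u : R) :
  in_open_interval a b s -> in_open_interval a b u -> s <= t <= u ->
  in_open_interval a b t.
Proof.
  intros [Hs _] [_ Hu] [Hst Htu]; split.
  - apply Rbar_lt_le_trans with (1 := Hs); exact Hst.
  - apply Rbar_le_lt_trans with (2 := Hu); exact Htu.
Qed.

Lemma open_interval_between (a b : Rbar) (s t u : R) :
  in_open_interval a b s -> in_open_interval a b t ->
  Rmin s t <= u <= Rmax s t -> in_open_interval a b u.
Proof.
  intros Hs Ht Hu; destruct (Rle_dec s t) as [Hst | Hst].
  - rewrite Rmin_left, Rmax_right in Hu by exact Hst.
    exact (open_interval_convex a b s u t Hs Ht Hu).
  - rewrite Rmin_right, Rmax_left in Hu by lra.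
    exact (open_interval_convex a b t u s Ht Hs Hu).
Qed.

Lemma open_interval_around (a b : Rbar) (s e : R) :
  in_open_interval a b s -> 0 < e ->
  exists d, 0 < d < e /\ in_open_interval a b (s - d) /\ in_open_interval a b (s + d).
Proof.
  intros Hs He; destruct (open_interval_locally a b s Hs) as [r Hr].
  assert (Hr0 := cond_pos r).
  exists (Rmin r e / 2).
  assert (0 < Rmin r e) by (apply Rmin_glb_lt; lra).
  assert (Rmin r e <= r) by apply Rmin_l.
  assert (Rmin r e <= e) by apply Rmin_r.
  split; [lra |].
  split; apply Hr; apply Rabs_def1; unfold minus, plus, opp; simpl; lra.
Qed.

Lemma constant_on_open_interval (a b : Rbar) (F : R -> R) (s t : R) :
  (forall u, in_open_interval a b u -> is_derive F u 0) ->
  in_open_interval a b s -> in_open_interval a b t -> F s = F t.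
Proof.
  intros HF Hs Ht.
  destruct (MVT_gen F s t (fun _ => 0)) as [u [_ Hu]].
  - intros u Hu; apply HF, (open_interval_between a b s t); auto; lra.
  - intros u Hu; apply continuity_pt_filterlim, (ex_derive_continuous F).
    exists 0; apply HF, (open_interval_between a b s t); auto.
  - lra.
Qed.

Lemma antiderivative_on_open_interval (a b : Rbar) (q : R -> R) (s0 : R) :
  in_open_interval a b s0 ->
  (forall s, in_open_interval a b s -> continuous q s) ->
  exists h, forall s, in_open_interval a b s -> is_derive h s (q s).
Proof.
  intros Hs0 Hq; exists (RInt q s0); intros s Hs.
  apply (is_derive_RInt q (RInt q s0) s0); [| exact (Hq s Hs)].
  apply filter_imp with (2 := open_interval_locally a b s Hs); intros t Ht.
  apply (RInt_correct q), ex_RInt_continuous; intros u Hu.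
  apply Hq, (open_interval_between a b s0 t); auto.
Qed.

(** * Differentiable inverses of strictly monotone functions *)

(** The difference quotient of [g] at [s] is the reciprocal of one of [h] at [g s], and continuity
    of [g] makes the increment of [h]'s argument small. *)
Lemma is_derive_inverse_function (h g : R -> R) (s q : R) :
  is_derive h (g s) q -> 0 < q -> continuous g s ->
  locally s (fun t => h (g t) = t) -> is_derive g s (/ q).
Proof.
  intros Hh Hq Hg Hhg; apply is_derive_Reals; apply is_derive_Reals in Hh.
  intros e He.
  assert (Hs : h (g s) = s) by exact (locally_singleton _ _ Hhg).
  (* The first bound keeps the quotient [r'] of [h] above [q / 2]. With the second,
     [|1/r' - 1/q| = |r' - q| / (r' q)] is below [(e q^2 / 2) / (q^2 / 2) = e]. *)
  assert (Hd : 0 < Rmin (q / 2) (e * (q * q) / 2)).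
  { apply Rmin_glb_lt; [lra |].
    assert (0 < q * q) by (apply Rmult_lt_0_compat; lra).
    assert (0 < e * (q * q)) by (apply Rmult_lt_0_compat; lra). lra. }
  destruct (Hh _ Hd) as [d Hd'].
  assert (Hgd : locally s (fun t => ball (g s) d (g t))).
  { apply Hg. exists d; auto. }
  destruct (filter_and _ _ Hgd Hhg) as [r Hr].
  exists r; intros k Hk0 Hkr.
  destruct (Hr (s + k)) as [Hb Hgk].
  { unfold ball; simpl; unfold AbsRing_ball, abs, minus, plus, opp; simpl.
    replace (s + k + - s) with k by ring; exact Hkr. }
  set (j := g (s + k) - g s).
  assert (Hj : h (g s + j) - h (g s) = k).
  { unfold j; replace (g s + (g (s + k) - g s)) with (g (s + k)) by ring.
    rewrite Hgk, Hs; ring. }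
  (* [h] changes by [k <> 0] over the increment [j]. *)
  assert (Hj0 : j <> 0).
  { intros H; rewrite H, Rplus_0_r in Hj; lra. }
  assert (Hjd : Rabs j < d) by exact Hb.
  assert (Hjq := Hd' j Hj0 Hjd); rewrite Hj in Hjq.
  assert (H1 := Rmin_l (q / 2) (e * (q * q) / 2)).
  assert (H2 := Rmin_r (q / 2) (e * (q * q) / 2)).
  set (r' := k / j) in *.
  assert (Hr' : q / 2 < r').
  { apply Rabs_def2 in Hjq; lra. }
  replace (j / k) with (/ r') by (unfold r'; field; auto).
  replace (/ r' - / q) with ((q - r') * / (r' * q)) by (field; lra).
  assert (Hrq : 0 < r' * q) by (apply Rmult_lt_0_compat; lra).
  rewrite Rabs_mult, Rabs_minus_sym, (Rabs_right (/ (r' * q)))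
    by (left; apply Rinv_0_lt_compat; exact Hrq).
  apply Rmult_lt_reg_r with (r' * q); [exact Hrq |].
  rewrite Rmult_assoc, Rinv_l, Rmult_1_r by lra.
  assert (q / 2 * q < r' * q) by (apply Rmult_lt_compat_r; lra).
  assert (e * (q / 2 * q) < e * (r' * q)) by (apply Rmult_lt_compat_l; lra).
  lra.
Qed.

(** The image of the interval is again an open interval, from the infimum to the supremum of the
    values: strict monotonicity keeps both from being attained, and the intermediate value theorem
    fills the gap. *)
Lemma inverse_of_increasing (a b : Rbar) (h q : R -> R) :
  (forall t, in_open_interval a b t -> is_derive h t (q t)) ->
  (forall t, in_open_interval a b t -> 0 < q t) ->
  exists (a' b' : Rbar) (g : R -> R),
    (forall t, in_open_interval a b t ->
       in_open_interval a' b' (h t) /\ g (h t) = t) /\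
    (forall s, in_open_interval a' b' s ->
       in_open_interval a b (g s) /\ h (g s) = s /\ is_derive g s (/ q (g s))).
Proof.
  intros Hh Hq.
  assert (Hinc : forall t u, in_open_interval a b t -> in_open_interval a b u ->
                 t < u -> h t < h u).
  { intros t u [Ht _] [_ Hu] Htu.
    apply (incr_function h a b q); auto.
    - intros x H1 H2; apply Hh; split; assumption.
    - intros x H1 H2; apply Hq; split; assumption. }
  assert (Hinj : forall t u, in_open_interval a b t -> in_open_interval a b u ->
                 h t = h u -> t = u).
  { intros t u Ht Hu Htu.
    destruct (Rtotal_order t u) as [H | [H | H]]; auto.
    - apply Hinc in H; auto; lra.
    - apply Hinc in H; auto; lra. }
  set (E := fun s => exists t, in_open_interval a b t /\ h t = s).
  set (a' := Glb_Rbar E); set (b' := Lub_Rbar E).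
  destruct (Glb_Rbar_correct E) as [Ha1 Ha2]; fold a' in Ha1, Ha2.
  destruct (Lub_Rbar_correct E) as [Hb1 Hb2]; fold b' in Hb1, Hb2.
  assert (Himg : forall t, in_open_interval a b t -> in_open_interval a' b' (h t)).
  { intros t Ht.
    destruct (open_interval_around a b t 1 Ht Rlt_0_1) as [d [Hd [Hl Hr]]].
    split.
    - apply Rbar_le_lt_trans with (h (t - d)).
      + apply Ha1; exists (t - d); auto.
      + apply Hinc; auto; lra.
    - apply Rbar_lt_le_trans with (h (t + d)).
      + apply Hinc; auto; lra.
      + apply Hb1; exists (t + d); auto. }
  assert (Hsurj : forall s, in_open_interval a' b' s -> E s).
  { intros s [Hsa Hsb].
    (* Otherwise [s] would be a lower bound of the image, above its infimum; symmetrically for the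
       supremum. *)
    assert (Hlo : exists t, in_open_interval a b t /\ h t < s).
    { apply NNPP; intros Hno; apply (Rbar_lt_not_le _ _ Hsa), Ha2.
      intros u [t [Ht Htu]]; apply Rbar_not_lt_le; intros Hus; apply Hno.
      exists t; split; [exact Ht | rewrite Htu; exact Hus]. }
    assert (Hhi : exists t, in_open_interval a b t /\ s < h t).
    { apply NNPP; intros Hno; apply (Rbar_lt_not_le _ _ Hsb), Hb2.
      intros u [t [Ht Htu]]; apply Rbar_not_lt_le; intros Hus; apply Hno.
      exists t; split; [exact Ht | rewrite Htu; exact Hus]. }
    destruct Hlo as [t1 [Ht1 Hs1]], Hhi as [t2 [Ht2 Hs2]].
    assert (Hcont : forall t, in_open_interval a b t -> continuity_pt h t).
    { intros t Ht; apply continuity_pt_filterlim, (ex_derive_continuous h).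
      exists (q t); auto. }
    assert (Ht12 : t1 < t2).
    { destruct (Rtotal_order t1 t2) as [H | [H | H]]; auto.
      - subst; lra.
      - apply Hinc in H; auto; lra. }
    destruct (IVT_Rbar_incr h t1 t2 (h t1) (h t2) s) as [t [Hl [Hr Ht]]].
    - apply is_lim_continuity; auto.
    - apply is_lim_continuity; auto.
    - intros t Hl Hr; apply Hcont, (open_interval_convex a b t1 t t2); auto.
      simpl in Hl, Hr; lra.
    - exact Ht12.
    - split; assumption.
    - exists t; split; [| exact Ht].
      apply (open_interval_convex a b t1 t t2); auto; simpl in Hl, Hr; lra. }
  (* A preimage is chosen for each [s]; outside the image the value is arbitrary. *)
  set (g := fun s => ClassicalEpsilon.epsilon (inhabits 0) (fun t => in_open_interval a b t /\ h t = s)).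
  assert (Hg : forall s, in_open_interval a' b' s ->
               in_open_interval a b (g s) /\ h (g s) = s).
  { intros s Hs.
    exact (ClassicalEpsilon.epsilon_spec (inhabits 0) (fun t => in_open_interval a b t /\ h t = s)
             (Hsurj s Hs)). }
  exists a', b', g; split.
  - intros t Ht; split; [auto |].
    destruct (Hg (h t) (Himg t Ht)); auto.
  - intros s Hs; destruct (Hg s Hs) as [Hgs Hhgs].
    split; [exact Hgs |]; split; [exact Hhgs |].
    apply is_derive_inverse_function with (h := h); auto.
    (* Continuity of [g] at [s]: by monotonicity, values between [h (g s - d)] and [h (g s + d)]
       have their preimages within [d] of [g s]. *)
    + intros P [e HP].
      destruct (open_interval_around a b (g s) e Hgs (cond_pos e))
        as [d [Hd [Hl Hr]]].
      assert (Hs' : in_open_interval (h (g s - d)) (h (g s + d)) s).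
      { split; simpl.
        - apply Rlt_le_trans with (h (g s)); [apply Hinc; auto; lra | lra].
        - apply Rle_lt_trans with (h (g s)); [lra | apply Hinc; auto; lra]. }
      assert (HL := open_interval_locally _ _ _ Hs').
      apply filter_imp with (2 := filter_and _ _ HL (open_interval_locally _ _ _ Hs)).
      intros u [[Hu1 Hu2] Hu]; simpl in Hu1, Hu2; apply HP.
      destruct (Hg u Hu) as [Hgu Hhgu]; rewrite <- Hhgu in Hu1, Hu2.
      assert (g s - d < g u).
      { destruct (Rtotal_order (g s - d) (g u)) as [H | [H | H]]; auto.
        - rewrite H in Hu1; lra.
        - apply Hinc in H; auto; lra. }
      assert (g u < g s + d).
      { destruct (Rtotal_order (g u) (g s + d)) as [H' | [H' | H']]; auto.
        - rewrite H' in Hu2; lra.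
        - apply Hinc in H'; auto; lra. }
      apply Rabs_def1; unfold minus, plus, opp; simpl; lra.
    + apply filter_imp with (2 := open_interval_locally _ _ _ Hs).
      intros u Hu; apply Hg, Hu.
Qed.

(** For [theta = -1] the increasing function [- h] is inverted; the image interval is then reflected
    and the inverse precomposed with negation. *)
Lemma inverse_of_monotone (a b : Rbar) (h q : R -> R) (theta : R) :
  is_sign theta ->
  (forall t, in_open_interval a b t -> is_derive h t (q t)) ->
  (forall t, in_open_interval a b t -> 0 < theta * q t) ->
  exists (a' b' : Rbar) (g : R -> R),
    (forall t, in_open_interval a b t ->
       in_open_interval a' b' (h t) /\ g (h t) = t) /\
    (forall s, in_open_interval a' b' s ->
       in_open_interval a b (g s) /\ h (g s) = s /\ is_derive g s (/ q (g s))).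
Proof.
  intros [-> | ->] Hh Hq.
  { apply inverse_of_increasing; auto.
    intros t Ht; specialize (Hq t Ht); lra. }
  destruct (inverse_of_increasing a b (fun t => - h t) (fun t => - q t))
    as [a' [b' [g [H1 H2]]]].
  - intros t Ht; apply (is_derive_opp h), Hh, Ht.
  - intros t Ht; specialize (Hq t Ht); lra.
  - assert (Hopp : forall s, in_open_interval (Rbar_opp b') (Rbar_opp a') s <->
                   in_open_interval a' b' (- s)).
    { intros s; unfold in_open_interval; split; intros [Hl Hr]; split;
        apply Rbar_opp_lt; simpl; rewrite ?Rbar_opp_involutive, ?Ropp_involutive;
        assumption. }
    exists (Rbar_opp b'), (Rbar_opp a'), (fun s => g (- s)); split.
    + intros t Ht; destruct (H1 t Ht) as [Hin Hg]; split; [apply Hopp |]; assumption.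
    + intros s Hs; destruct (H2 (- s) (proj1 (Hopp s) Hs)) as [Hin [Hhg Hg]].
      split; [exact Hin |]; split; [lra |].
      replace (/ q (g (- s))) with (scal (-1) (/ - q (g (- s)))).
      * apply (is_derive_comp g Ropp s); [exact Hg |].
        auto_derive; [exact I | ring].
      * unfold scal; simpl; unfold mult; simpl; field.
        specialize (Hq _ Hin); intros H; rewrite H in Hq; lra.
Qed.

(** * Signed hyperbolic functions and the signs of forms and kinds *)

(** For [d = 1] the pair [hsin], [hcos] is sinh, cosh; for [d = -1] it is cosh, sinh. Each is the
    derivative of the other for every [d]. *)
Definition hsin (d t : R) : R := (exp t - d * exp (- t)) / 2.

Definition hcos (d t : R) : R := (exp t + d * exp (- t)) / 2.

(** The sign of [- x^2 + y^2] at the points of the form. *)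
Definition form_sign (f : form) : R :=
  match f with sinh_cosh => 1 | cosh_sinh => -1 end.

Definition kind_sign (k : kind) : R :=
  match k with kind_plus => 1 | kind_minus => -1 end.

Lemma is_derive_hsin (d t : R) : is_derive (hsin d) t (hcos d t).
Proof. unfold hsin, hcos; auto_derive; [exact I | field]. Qed.

Lemma is_derive_hcos (d t : R) : is_derive (hcos d) t (hsin d t).
Proof. unfold hsin, hcos; auto_derive; [exact I | field]. Qed.

Lemma exp_mul_exp_opp (t : R) : exp t * exp (- t) = 1.
Proof. rewrite <- exp_plus, Rplus_opp_r; apply exp_0. Qed.

Lemma hcos_sqr_sub_hsin_sqr (d t : R) : hcos d t ^ 2 - hsin d t ^ 2 = d.
Proof.
  unfold hsin, hcos; assert (H := exp_mul_exp_opp t).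
  transitivity (d * (exp t * exp (- t))); [field | rewrite H; ring].
Qed.

Lemma hsin_plus (d e s t : R) :
  hsin (d * e) (s + t) = hsin d s * hcos e t + hcos d s * hsin e t.
Proof. unfold hsin, hcos; rewrite Ropp_plus_distr, !exp_plus; field. Qed.

Lemma hcos_plus (d e s t : R) :
  hcos (d * e) (s + t) = hcos d s * hcos e t + hsin d s * hsin e t.
Proof. unfold hsin, hcos; rewrite Ropp_plus_distr, !exp_plus; field. Qed.

Lemma sinh_hsin (t : R) : sinh t = hsin 1 t.
Proof. unfold sinh, hsin; field. Qed.

Lemma cosh_hcos (t : R) : cosh t = hcos 1 t.
Proof. unfold cosh, hcos; field. Qed.

Lemma pseudopolar_hsin (f : form) (tau rho nu : R) :
  pseudopolar f tau rho nu =
  (tau * (rho * hsin (form_sign f) nu), tau * (rho * hcos (form_sign f) nu)).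
Proof.
  destruct f; simpl; unfold sinh, cosh, hsin, hcos; f_equal; field.
Qed.

Lemma spiral_equation_hsin (k : kind) (lambda n rho nu : R) :
  spiral_equation k lambda n rho nu <->
  lambda * Rpower rho n = (n + 1) * hsin (kind_sign k) (n * nu).
Proof.
  replace (hsin (kind_sign k) (n * nu)) with
    (match k with kind_plus => sinh (n * nu) | kind_minus => cosh (n * nu) end)
    by (destruct k; simpl; unfold sinh, cosh, hsin; field).
  destruct k; reflexivity.
Qed.

Lemma kind_sign_of (c : causal) (f : form) :
  kind_sign (kind_of c f) = epsilon c * form_sign f.
Proof. destruct c, f; simpl; ring. Qed.

Lemma is_sign_sqr (t : R) : is_sign t -> t * t = 1.
Proof. intros [-> | ->]; ring. Qed.

Lemma is_sign_of_nonzero (r : R) : r <> 0 -> exists sigma, is_sign sigma /\ 0 < sigma * r.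
Proof.
  intros Hr; destruct (Rlt_dec 0 r).
  - exists 1; split; [left; reflexivity | lra].
  - exists (-1); split; [right; reflexivity | lra].
Qed.

Lemma is_sign_form (f : form) : is_sign (form_sign f).
Proof. destruct f; [left | right]; reflexivity. Qed.

Lemma is_sign_epsilon (c : causal) : is_sign (epsilon c).
Proof. destruct c; [left | right]; reflexivity. Qed.

(** * Boosts, derivatives and the Frenet equation in pseudopolar coordinates *)

Lemma boost_pseudopolar (f : form) (tau rho nu a : R) :
  boost a (pseudopolar f tau rho nu) = pseudopolar f tau rho (nu + a).
Proof.
  rewrite !pseudopolar_hsin; unfold boost; simpl.
  rewrite cosh_hcos, sinh_hsin.
  (* The boost has ordinary sinh and cosh, of sign 1, so the sign on the right-hand side is written
     as a product to fit the addition formulas. *)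
  replace (form_sign f) with (form_sign f * 1) at 5 6 by ring.
  rewrite hsin_plus, hcos_plus; f_equal; ring.
Qed.

Lemma is_derive_pseudopolar (f : form) (tau : R) (a b : Rbar)
    (gamma : R -> R * R) (rho nu : R -> R) (s rho' nu' : R) :
  pseudopolar_coordinates f tau a b gamma rho nu -> in_open_interval a b s ->
  is_derive rho s rho' -> is_derive nu s nu' ->
  let S := hsin (form_sign f) (nu s) in
  let C := hcos (form_sign f) (nu s) in
  is_derive (fun t => fst (gamma t)) s (tau * (rho' * S + rho s * nu' * C)) /\
  is_derive (fun t => snd (gamma t)) s (tau * (rho' * C + rho s * nu' * S)).
Proof.
  intros Hpp Hs Hrho Hnu S C.
  assert (Hloc : forall (u : R * R -> R),
            locally s (fun t => u (pseudopolar f tau (rho t) (nu t)) = u (gamma t))).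
  { intros u; apply filter_imp with (2 := open_interval_locally a b s Hs).
    intros t Ht; destruct (Hpp t Ht) as [_ ->]; reflexivity. }
  assert (HS : is_derive (fun t => hsin (form_sign f) (nu t)) s (nu' * C))
    by (apply (is_derive_comp (hsin (form_sign f)) nu);
        [apply is_derive_hsin | exact Hnu]).
  assert (HC : is_derive (fun t => hcos (form_sign f) (nu t)) s (nu' * S))
    by (apply (is_derive_comp (hcos (form_sign f)) nu);
        [apply is_derive_hcos | exact Hnu]).
  split.
  - apply is_derive_ext_loc with (1 := Hloc fst).
    apply is_derive_ext with (fun t => tau * (rho t * hsin (form_sign f) (nu t))).
    { intros t; rewrite pseudopolar_hsin; reflexivity. }
    replace (rho' * S + rho s * nu' * C) with (rho' * S + rho s * (nu' * C)) by ring.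
    apply (is_derive_scal (fun t => rho t * hsin (form_sign f) (nu t))).
    apply (is_derive_mult rho); auto; intros; apply Rmult_comm.
  - apply is_derive_ext_loc with (1 := Hloc snd).
    apply is_derive_ext with (fun t => tau * (rho t * hcos (form_sign f) (nu t))).
    { intros t; rewrite pseudopolar_hsin; reflexivity. }
    replace (rho' * C + rho s * nu' * S) with (rho' * C + rho s * (nu' * S)) by ring.
    apply (is_derive_scal (fun t => rho t * hcos (form_sign f) (nu t))).
    apply (is_derive_mult rho); auto; intros; apply Rmult_comm.
Qed.

(* The null coordinates [tau (y + x)] and [tau (y - x)] of the curve are
   [rho e^nu] and [rho e^-nu], up to a sign, so they determine [rho] and [nu]
   smoothly. *)
Lemma pseudopolar_differentiable (f : form) (tau : R) (a b : Rbar)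
    (gamma : R -> R * R) (rho nu : R -> R) (s : R) :
  is_sign tau ->
  pseudopolar_coordinates f tau a b gamma rho nu -> in_open_interval a b s ->
  ex_derive (fun t => fst (gamma t)) s -> ex_derive (fun t => snd (gamma t)) s ->
  ex_derive rho s /\ ex_derive nu s.
Proof.
  intros Htau Hpp Hs Hx Hy.
  assert (Htau2 := is_sign_sqr tau Htau).
  assert (Hd2 := is_sign_sqr _ (is_sign_form f)).
  set (p := fun t => tau * (snd (gamma t) + fst (gamma t))).
  (* Since [hcos d t - hsin d t = d e^(-t)], the factor [form_sign f] makes [m] equal to the
     positive [rho e^(- nu)]. *)
  set (m := fun t => tau * (form_sign f * (snd (gamma t) - fst (gamma t)))).
  assert (Hp : ex_derive p s).
  { apply (ex_derive_scal (fun t => snd (gamma t) + fst (gamma t))).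
    apply @ex_derive_plus; assumption. }
  assert (Hm : ex_derive m s).
  { apply (ex_derive_scal (fun t => form_sign f * (snd (gamma t) - fst (gamma t)))).
    apply (ex_derive_scal (fun t => snd (gamma t) - fst (gamma t))).
    apply @ex_derive_minus; assumption. }
  assert (Hpm : forall t, in_open_interval a b t ->
            0 < rho t /\ p t = rho t * exp (nu t) /\ m t = rho t * exp (- nu t)).
  { intros t Ht; destruct (Hpp t Ht) as [Hr Hg].
    rewrite pseudopolar_hsin in Hg.
    split; [exact Hr |]; unfold p, m; rewrite Hg; simpl; unfold hsin, hcos; split.
    - transitivity (tau * tau * (rho t * exp (nu t))); [field | rewrite Htau2; ring].
    - transitivity (tau * tau * (form_sign f * form_sign f) * (rho t * exp (- nu t)));
        [field | rewrite Htau2, Hd2; ring]. }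
  assert (Hpos : 0 < p s /\ 0 < m s).
  { destruct (Hpm s Hs) as [Hr [-> ->]].
    split; apply Rmult_lt_0_compat; auto; apply exp_pos. }
  destruct Hpos as [Hp0 Hm0].
  split.
  - apply ex_derive_ext_loc with (fun t => sqrt (p t * m t)).
    + apply filter_imp with (2 := open_interval_locally a b s Hs); intros t Ht.
      destruct (Hpm t Ht) as [Hr [-> ->]].
      replace (rho t * exp (nu t) * (rho t * exp (- nu t)))
        with (rho t * rho t * (exp (nu t) * exp (- nu t))) by ring.
      rewrite exp_mul_exp_opp, Rmult_1_r; apply sqrt_square; lra.
    + auto_derive; repeat split; auto; apply Rmult_lt_0_compat; auto.
  - apply ex_derive_ext_loc with (fun t => (ln (p t) - ln (m t)) / 2).
    + apply filter_imp with (2 := open_interval_locally a b s Hs); intros t Ht.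
      destruct (Hpm t Ht) as [Hr [-> ->]].
      rewrite !ln_mult, !ln_exp by auto using exp_pos.
      assert (forall l v : R, (l + v - (l + - v)) / 2 = v) by (intros; field); auto.
    + auto_derive; repeat split; auto.
Qed.

(* The equation [T' = kappa N]. *)
Lemma is_derive_velocity (c : causal) (a b : Rbar) (gamma : R -> R * R) (s : R) :
  unit_speed c a b gamma -> in_open_interval a b s ->
  is_derive (fun t => fst (velocity gamma t)) s
    (curvature c gamma s * snd (velocity gamma s)) /\
  is_derive (fun t => snd (velocity gamma t)) s
    (curvature c gamma s * fst (velocity gamma s)).
Proof.
  intros Hus Hs.
  destruct (Hus s Hs) as [[_ Hx] [[_ Hy] Hg]].
  set (X := fun t => fst (velocity gamma t)).
  set (Y := fun t => snd (velocity gamma t)).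
  change (ex_derive X s) in Hx; change (ex_derive Y s) in Hy.
  assert (He := is_sign_sqr _ (is_sign_epsilon c)).
  assert (Hg' : - (X s * X s) + Y s * Y s = epsilon c) by exact Hg.
  (* Differentiating the constant [g(T, T)] shows that [T'] is orthogonal to [T], hence a multiple
     of [N]. *)
  assert (H0 : - (2 * X s * Derive X s) + 2 * Y s * Derive Y s = 0).
  { transitivity (Derive (fun t => - (X t * X t) + Y t * Y t) s).
    - symmetry; apply is_derive_unique; auto_derive; [auto |].
      change (Derive (fun x => X x) s) with (Derive X s).
      change (Derive (fun x => Y x) s) with (Derive Y s). ring.
    - rewrite (Derive_ext_loc _ (fun _ => epsilon c)); [apply Derive_const |].
      apply filter_imp with (2 := open_interval_locally a b s Hs); intros t Ht.
      apply (Hus t Ht). }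
  assert (Hk : curvature c gamma s
               = epsilon c * (Derive X s * Y s - X s * Derive Y s)) by reflexivity.
  change (snd (velocity gamma s)) with (Y s).
  change (fst (velocity gamma s)) with (X s).
  rewrite Hk.
  assert (HYY : Y s * Derive Y s = X s * Derive X s) by lra.
  split.
  - replace (epsilon c * (Derive X s * Y s - X s * Derive Y s) * Y s) with (Derive X s).
    { apply Derive_correct, Hx. }
    transitivity (epsilon c * (Derive X s * (Y s * Y s) - X s * (Y s * Derive Y s)));
      [| ring].
    rewrite HYY.
    transitivity (epsilon c * (- (X s * X s) + Y s * Y s) * Derive X s); [| ring].
    rewrite Hg', He; ring.
  - replace (epsilon c * (Derive X s * Y s - X s * Derive Y s) * X s) with (Derive Y s).
    { apply Derive_correct, Hy. }
    transitivity (epsilon c * (Y s * (X s * Derive X s) - X s * X s * Derive Y s));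
      [| ring].
    rewrite <- HYY.
    transitivity (epsilon c * (- (X s * X s) + Y s * Y s) * Derive Y s); [| ring].
    rewrite Hg', He; ring.
Qed.

(** * The momentum condition and the first integrals *)

Lemma Rpower_minus_1 (r n : R) : 0 < r -> Rpower r (n - 1) = Rpower r n / r.
Proof.
  intros Hr; unfold Rminus; rewrite Rpower_plus, Rpower_Ropp, Rpower_1 by exact Hr.
  reflexivity.
Qed.

Lemma Rpower_plus_1 (r n : R) : 0 < r -> Rpower r (n + 1) = Rpower r n * r.
Proof. intros Hr; rewrite Rpower_plus, Rpower_1 by exact Hr; reflexivity. Qed.

(** Dividing the momentum by [rho] gives the first equation; dividing that by [rho] once more gives
    [lambda rho^(n-1)], the curvature. *)
Lemma momentum_velocity (c : causal) (lambda n : R) (a b : Rbar)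
    (gamma : R -> R * R) (rho nu : R -> R) (s : R) :
  n <> -1 -> 0 < rho s ->
  has_momentum_and_curvature c lambda n a b gamma rho nu ->
  in_open_interval a b s ->
  (n + 1) * (rho s * Derive nu s) = lambda * Rpower (rho s) n /\
  curvature c gamma s = (n + 1) * Derive nu s.
Proof.
  intros Hn1 Hr Hmk Hs; destruct (Hmk s Hs) as [HK ->].
  unfold angular_momentum in HK; rewrite Rpower_plus_1 in HK by exact Hr.
  assert (H : (n + 1) * (rho s * Derive nu s) = lambda * Rpower (rho s) n).
  { apply Rmult_eq_reg_r with (rho s); [| lra].
    transitivity ((n + 1) * (rho s ^ 2 * Derive nu s)); [ring |].
    rewrite HK; field; lra. }
  split; [exact H |]; rewrite Rpower_minus_1 by exact Hr.
  apply Rmult_eq_reg_r with (rho s); [| lra].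
  transitivity (lambda * Rpower (rho s) n); [field; lra | rewrite <- H; ring].
Qed.

(* Since [kappa = (n + 1) nu'], the equation [T' = kappa N] gives the first
   integrals [tau (y' + x') e^(- (n+1) nu)] and [tau (y' - x') e^((n+1) nu)]. *)
Lemma null_velocity_first_integrals (c : causal) (f : form) (tau lambda n : R)
    (a b : Rbar) (gamma : R -> R * R) (rho nu : R -> R) :
  n <> -1 -> is_sign tau ->
  unit_speed c a b gamma ->
  pseudopolar_coordinates f tau a b gamma rho nu ->
  has_momentum_and_curvature c lambda n a b gamma rho nu ->
  forall s0, in_open_interval a b s0 ->
  exists c1 c2, c1 * c2 = kind_sign (kind_of c f) /\
    forall s, in_open_interval a b s ->
      Derive rho s + rho s * Derive nu s = c1 * exp (n * nu s) /\
      Derive rho s - rho s * Derive nu s = c2 * exp (- (n * nu s)).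
Proof.
  intros Hn1 Htau Hus Hpp Hmk s0 Hs0.
  assert (Htau2 := is_sign_sqr tau Htau).
  assert (Hd2 := is_sign_sqr _ (is_sign_form f)).
  set (d := form_sign f) in *.
  set (X := fun t => fst (velocity gamma t)).
  set (Y := fun t => snd (velocity gamma t)).
  set (C1 := fun t => tau * (Y t + X t) * exp (- ((n + 1) * nu t))).
  (* The factor [d] makes [tau d (y' - x')] the derivative of [rho e^(- nu)], so that [C2] equals
     [(rho' - rho nu') e^(n nu)]. *)
  set (C2 := fun t => tau * d * (Y t - X t) * exp ((n + 1) * nu t)).
  assert (Hder : forall s, in_open_interval a b s -> ex_derive rho s /\ ex_derive nu s).
  { intros s Hs; destruct (Hus s Hs) as [[Hx _] [[Hy _] _]].
    exact (pseudopolar_differentiable f tau a b gamma rho nu s Htau Hpp Hs Hx Hy). }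
  assert (HC1 : forall s, in_open_interval a b s -> is_derive C1 s 0).
  { intros s Hs; destruct (is_derive_velocity c a b gamma s Hus Hs) as [HX HY].
    destruct (momentum_velocity c lambda n a b gamma rho nu s Hn1
                (proj1 (Hpp s Hs)) Hmk Hs) as [_ Hk].
    destruct (Hder s Hs) as [_ Hnu].
    unfold C1; auto_derive.
    - repeat split; eauto; eexists; [exact HY | exact HX].
    - change (Derive (fun x => nu x) s) with (Derive nu s).
      replace (Derive (fun x => Y x) s) with (curvature c gamma s * X s)
        by (symmetry; apply is_derive_unique; exact HY).
      replace (Derive (fun x => X x) s) with (curvature c gamma s * Y s)
        by (symmetry; apply is_derive_unique; exact HX).
      rewrite Hk; ring. }
  assert (HC2 : forall s, in_open_interval a b s -> is_derive C2 s 0).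
  { intros s Hs; destruct (is_derive_velocity c a b gamma s Hus Hs) as [HX HY].
    destruct (momentum_velocity c lambda n a b gamma rho nu s Hn1
                (proj1 (Hpp s Hs)) Hmk Hs) as [_ Hk].
    destruct (Hder s Hs) as [_ Hnu].
    unfold C2; auto_derive.
    - repeat split; eauto; eexists; [exact HY | exact HX].
    - change (Derive (fun x => nu x) s) with (Derive nu s).
      replace (Derive (fun x => Y x) s) with (curvature c gamma s * X s)
        by (symmetry; apply is_derive_unique; exact HY).
      replace (Derive (fun x => X x) s) with (curvature c gamma s * Y s)
        by (symmetry; apply is_derive_unique; exact HX).
      rewrite Hk; ring. }
  exists (C1 s0), (C2 s0); split.
  (* The exponentials cancel in [C1 C2], leaving [d g(T, T) = d epsilon], the sign of the kind. *)
  { destruct (Hus s0 Hs0) as [_ [_ Hg]].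
    change (- (X s0 * X s0) + Y s0 * Y s0 = epsilon c) in Hg.
    unfold C1, C2.
    transitivity (tau * tau * d * (- (X s0 * X s0) + Y s0 * Y s0) *
                  (exp ((n + 1) * nu s0) * exp (- ((n + 1) * nu s0)))); [ring |].
    rewrite Hg, Htau2, exp_mul_exp_opp, kind_sign_of; fold d; ring. }
  intros s Hs.
  rewrite (constant_on_open_interval a b C1 s0 s HC1 Hs0 Hs).
  rewrite (constant_on_open_interval a b C2 s0 s HC2 Hs0 Hs).
  destruct (Hder s Hs) as [Hrho Hnu].
  destruct (is_derive_pseudopolar f tau a b gamma rho nu s _ _ Hpp Hs
              (Derive_correct _ _ Hrho) (Derive_correct _ _ Hnu)) as [HX HY].
  assert (EX : X s = _) by exact (is_derive_unique _ _ _ HX).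
  assert (EY : Y s = _) by exact (is_derive_unique _ _ _ HY).
  fold d in EX, EY; unfold hsin, hcos in EX, EY.
  assert (E1 := exp_mul_exp_opp (nu s)).
  assert (E2 := exp_mul_exp_opp (n * nu s)).
  unfold C1, C2; rewrite EX, EY.
  replace ((n + 1) * nu s) with (n * nu s + nu s) by ring.
  rewrite Ropp_plus_distr, !exp_plus.
  split.
  (* The inserted factors [tau^2], [e^(n nu) e^(- n nu)] and [e^nu e^(- nu)] all equal 1. *)
  - transitivity (tau * tau * (Derive rho s + rho s * Derive nu s) *
      (exp (n * nu s) * exp (- (n * nu s))) * (exp (nu s) * exp (- nu s))).
    + rewrite Htau2, E1, E2; ring.
    + field.
  - transitivity (tau * tau * (d * d) * (Derive rho s - rho s * Derive nu s) *
      (exp (n * nu s) * exp (- (n * nu s))) * (exp (nu s) * exp (- nu s))).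
    + rewrite Htau2, Hd2, E1, E2; ring.
    + field.
Qed.

(** * Curves with the given momentum and curvature lie on a boosted spiral *)

(** The sign [sigma] is that of the first integral [c1], and the translation [nu0] of the angle
    absorbs its size; [c2] is then fixed by [c1 c2 = eta]. *)
Lemma curve_on_spiral (n lambda : R) (c : causal) (f : form) (tau : R)
    (a b : Rbar) (gamma : R -> R * R) (rho nu : R -> R) :
  n <> 0 -> n <> -1 -> 0 < lambda -> is_sign tau ->
  unit_speed c a b gamma ->
  pseudopolar_coordinates f tau a b gamma rho nu ->
  has_momentum_and_curvature c lambda n a b gamma rho nu ->
  exists sigma nu0 : R,
    spiral_sign (kind_of c f) n a b rho sigma /\
    forall s, in_open_interval a b s ->
      spiral c f tau (sigma * lambda) n (boost nu0 (gamma s)).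
Proof.
  intros Hn0 Hn1 Hlambda Htau Hus Hpp Hmk.
  set (k := kind_of c f).
  destruct (classic (exists s0, in_open_interval a b s0)) as [[s0 Hs0] | Hempty].
  (* On an empty interval only the condition [0 < sigma (n + 1)] of [kind_minus] has content, so
     [sigma] is taken as the sign of [n + 1]. *)
  2: { destruct (is_sign_of_nonzero (n + 1)) as [sigma [Hsigma Hpos]]; [lra |].
       exists sigma, 0; split; [split; [exact Hsigma |] |].
       - destruct k; [intros s Hs; elim Hempty; eauto | exact Hpos].
       - intros s Hs; elim Hempty; eauto. }
  destruct (null_velocity_first_integrals c f tau lambda n a b gamma rho nu
              Hn1 Htau Hus Hpp Hmk s0 Hs0) as [c1 [c2 [Hc12 Hc]]]; fold k in Hc12.
  set (eta := kind_sign k) in *.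
  assert (Heta : eta * eta = 1) by (unfold eta; destruct k; simpl; ring).
  assert (Hc1 : c1 <> 0).
  { intros H; rewrite H, Rmult_0_l in Hc12; rewrite <- Hc12 in Heta; lra. }
  destruct (is_sign_of_nonzero c1 Hc1) as [sigma [Hsigma Hpos]].
  assert (Hsigma2 := is_sign_sqr sigma Hsigma).
  (* Chosen so that [e^(n nu0) = |c1|]. *)
  set (nu0 := ln (sigma * c1) / n).
  assert (He1 : exp (n * nu0) = sigma * c1).
  { unfold nu0; replace (n * (ln (sigma * c1) / n)) with (ln (sigma * c1))
      by (field; exact Hn0); apply exp_ln, Hpos. }
  assert (He2 : exp (- (n * nu0)) = eta * sigma * c2).
  { apply Rmult_eq_reg_l with (exp (n * nu0)); [| rewrite He1; lra].
    rewrite exp_mul_exp_opp, He1.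
    transitivity (eta * eta * (sigma * sigma)); [rewrite Heta, Hsigma2; ring |].
    rewrite <- Hc12 at 2; ring. }
  assert (HS : forall s, in_open_interval a b s ->
            hsin eta (n * (nu s + nu0)) = sigma * (rho s * Derive nu s)).
  { intros s Hs; destruct (Hc s Hs) as [H1 H2]; unfold hsin.
    rewrite Rmult_plus_distr_l, Ropp_plus_distr, !exp_plus, He1, He2.
    transitivity (sigma * (c1 * exp (n * nu s)
                           - eta * eta * (c2 * exp (- (n * nu s)))) / 2); [field |].
    rewrite <- H1, <- H2, Heta; field. }
  assert (HC : forall s, in_open_interval a b s ->
            hcos eta (n * (nu s + nu0)) = sigma * Derive rho s).
  { intros s Hs; destruct (Hc s Hs) as [H1 H2]; unfold hcos.
    rewrite Rmult_plus_distr_l, Ropp_plus_distr, !exp_plus, He1, He2.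
    transitivity (sigma * (c1 * exp (n * nu s)
                           + eta * eta * (c2 * exp (- (n * nu s)))) / 2); [field |].
    rewrite <- H1, <- H2, Heta; field. }
  assert (Hmom : forall s, in_open_interval a b s ->
            (n + 1) * (rho s * Derive nu s) = lambda * Rpower (rho s) n).
  { intros s Hs; apply (momentum_velocity c lambda n a b gamma); auto.
    apply (Hpp s Hs). }
  exists sigma, nu0; split; [split; [exact Hsigma |] |].
  (* In [kind_plus], [sigma rho'] is a cosh, hence positive. In [kind_minus], [sigma rho nu'] is a
     cosh while [(n + 1) rho nu'] is [lambda rho^n > 0], so [sigma] and [n + 1] have the same
     sign. *)
  - destruct k; simpl in eta.
    + intros s Hs; rewrite <- HC by exact Hs; unfold hcos, eta.
      assert (H1 := exp_pos (n * (nu s + nu0))).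
      assert (H2 := exp_pos (- (n * (nu s + nu0)))); lra.
    + assert (Hhs := HS s0 Hs0); assert (Hm := Hmom s0 Hs0).
      assert (0 < hsin eta (n * (nu s0 + nu0))).
      { unfold hsin, eta.
        assert (H1 := exp_pos (n * (nu s0 + nu0))).
        assert (H2 := exp_pos (- (n * (nu s0 + nu0)))); lra. }
      assert (0 < lambda * Rpower (rho s0) n)
        by (apply Rmult_lt_0_compat; [exact Hlambda | apply exp_pos]).
      apply Rmult_lt_reg_r with (hsin eta (n * (nu s0 + nu0))); [assumption |].
      rewrite Hhs, Rmult_0_l.
      replace (sigma * (n + 1) * (sigma * (rho s0 * Derive nu s0)))
        with (sigma * sigma * ((n + 1) * (rho s0 * Derive nu s0))) by ring.
      rewrite Hsigma2, Hm; lra.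
  - intros s Hs; destruct (Hpp s Hs) as [Hr Hg].
    exists (rho s), (nu s + nu0); split; [exact Hr |]; split.
    + rewrite Hg; apply boost_pseudopolar.
    + apply spiral_equation_hsin; fold k; fold eta.
      rewrite HS, Rmult_assoc, <- Hmom by exact Hs; ring.
Qed.

(** * The spiral as a unit-speed curve *)

Lemma hsin_1_pos (u : R) : 0 < hsin 1 u <-> 0 < u.
Proof.
  unfold hsin; split; intros H.
  - apply Rnot_le_lt; intros Hu.
    assert (exp u <= exp (- u)).
    { destruct (Req_dec u 0) as [-> | Hu0]; [rewrite Ropp_0; lra |].
      left; apply exp_increasing; lra. }
    lra.
  - assert (exp (- u) < exp u) by (apply exp_increasing; lra); lra.
Qed.

Lemma hsin_1_opp (u : R) : hsin 1 (- u) = - hsin 1 u.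
Proof. unfold hsin; rewrite Ropp_involutive; field. Qed.

Lemma open_half_line (r : R) : r <> 0 ->
  exists (a b : Rbar) (t0 : R), in_open_interval a b t0 /\
    forall t, in_open_interval a b t <-> 0 < r * t.
Proof.
  intros Hr; destruct (Rlt_dec 0 r) as [Hr0 | Hr0].
  - exists 0, p_infty, 1; split; [split; simpl; [lra | exact I] |].
    intros t; split; [intros [H _]; apply Rmult_lt_0_compat; assumption |].
    intros H; split; [| exact I]; simpl.
    apply Rmult_lt_reg_l with r; [exact Hr0 | rewrite Rmult_0_r; exact H].
  - exists m_infty, 0, (-1); split; [split; simpl; [exact I | lra] |].
    intros t; split.
    + intros [_ H]; simpl in H.
      replace (r * t) with ((- r) * (- t)) by ring; apply Rmult_lt_0_compat; lra.
    + intros H; split; [exact I |]; simpl.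
      apply Ropp_lt_cancel, Rmult_lt_reg_l with (- r); [lra |].
      rewrite Ropp_0, Rmult_0_r; lra.
Qed.

(** These are the angles at which [rho^n = r hsin (n t)] has a positive solution [rho]: a half-line
    in [kind_plus], where sinh has the sign of its argument, and the whole line in [kind_minus],
    where cosh is positive. *)
Lemma spiral_angle_interval (k : kind) (n r : R) :
  n <> 0 -> r <> 0 -> (k = kind_minus -> 0 < r) ->
  exists (a b : Rbar) (t0 : R), in_open_interval a b t0 /\
    forall t, in_open_interval a b t <-> 0 < r * hsin (kind_sign k) (n * t).
Proof.
  intros Hn Hr Hk; destruct k; simpl.
  - destruct (open_half_line (r * n)) as [a [b [t0 [Ht0 H]]]].
    { apply Rmult_integral_contrapositive; auto. }
    exists a, b, t0; split; [exact Ht0 |].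
    intros t; rewrite H, Rmult_assoc.
    destruct (Rlt_dec 0 r) as [Hr0 | Hr0].
    + split; intros Hp; apply Rmult_lt_0_compat; auto.
      * apply hsin_1_pos; apply Rmult_lt_reg_l with r; lra.
      * apply hsin_1_pos; apply Rmult_lt_reg_l with r; lra.
    + replace (r * (n * t)) with ((- r) * (- (n * t))) by ring.
      replace (r * hsin 1 (n * t)) with ((- r) * hsin 1 (- (n * t)))
        by (rewrite hsin_1_opp; ring).
      split; intros Hp; apply Rmult_lt_0_compat; try lra.
      * apply hsin_1_pos; apply Rmult_lt_reg_l with (- r); lra.
      * apply hsin_1_pos; apply Rmult_lt_reg_l with (- r); lra.
  - exists m_infty, p_infty, 0; split; [split; exact I |].
    intros t; split; [intros _ | intros _; split; exact I].
    apply Rmult_lt_0_compat; [auto |]; unfold hsin.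
    assert (H1 := exp_pos (n * t)); assert (H2 := exp_pos (- (n * t))); lra.
Qed.

(* The curve is parametrized by the angle: with [G = sigma (n + 1) / lambda *
   hsin (n nu)] the spiral is [rho ^ n = G], and the momentum forces
   [ds / d nu = (n + 1) rho / (lambda G)]. *)
Lemma spiral_unit_speed_curve (n lambda : R) (c : causal) (f : form) (tau sigma : R) :
  n <> 0 -> n <> -1 -> 0 < lambda -> is_sign tau -> is_sign sigma ->
  (kind_of c f = kind_minus -> 0 < sigma * (n + 1)) ->
  exists (a b : Rbar) (gamma : R -> R * R) (rho nu : R -> R),
    unit_speed c a b gamma /\
    pseudopolar_coordinates f tau a b gamma rho nu /\
    has_momentum_and_curvature c lambda n a b gamma rho nu /\
    spiral_sign (kind_of c f) n a b rho sigma /\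
    (forall p : R * R,
       spiral c f tau (sigma * lambda) n p <->
       exists s, in_open_interval a b s /\ gamma s = p).
Proof.
  intros Hn0 Hn1 Hlambda Htau Hsigma Hminus.
  assert (Htau2 := is_sign_sqr tau Htau).
  assert (Hsigma2 := is_sign_sqr sigma Hsigma).
  assert (Heps2 := is_sign_sqr _ (is_sign_epsilon c)).
  assert (Hd2 := is_sign_sqr _ (is_sign_form f)).
  assert (Heta := kind_sign_of c f).
  set (eta := kind_sign (kind_of c f)) in *.
  (* As [sigma^2 = 1], the spiral equation solved for [rho^n] has this coefficient. *)
  set (k := sigma * (n + 1) / lambda).
  assert (Hsigma0 : sigma <> 0) by (intros H; rewrite H in Hsigma2; lra).
  assert (Hk0 : k <> 0).
  { unfold k, Rdiv; repeat apply Rmult_integral_contrapositive_currified; auto; [lra |].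
    apply Rinv_neq_0_compat; lra. }
  assert (Hk1 : kind_of c f = kind_minus -> 0 < k).
  { intros H; unfold k; apply Rdiv_lt_0_compat; auto. }
  destruct (spiral_angle_interval (kind_of c f) n k Hn0 Hk0 Hk1)
    as [ja [jb [t0 [Ht0 HJ]]]]; fold eta in HJ.
  set (G := fun t => k * hsin eta (n * t)).
  (* The [n]-th root of [G] where [G > 0]; as an exponential it is positive at every [t]. *)
  set (R_ := fun t => exp (ln (G t) / n)).
  assert (HR0 : forall t, 0 < R_ t) by (intros t; apply exp_pos).
  assert (HRn : forall t, in_open_interval ja jb t -> Rpower (R_ t) n = G t).
  { intros t Ht; apply HJ in Ht; unfold Rpower, R_; rewrite ln_exp.
    replace (n * (ln (G t) / n)) with (ln (G t)) by (field; exact Hn0).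
    apply exp_ln, Ht. }
  assert (HG' : forall t, is_derive G t (n * k * hcos eta (n * t))).
  { intros t.
    replace (n * k * hcos eta (n * t)) with (k * (n * hcos eta (n * t))) by ring.
    apply (is_derive_scal (fun t => hsin eta (n * t))).
    apply (is_derive_comp (hsin eta) (fun t => n * t)); [apply is_derive_hsin |].
    auto_derive; [exact I | ring]. }
  assert (HR' : forall t, in_open_interval ja jb t ->
            is_derive R_ t (R_ t * k * hcos eta (n * t) / G t)).
  { intros t Ht; apply HJ in Ht; change (0 < G t) in Ht.
    unfold R_; auto_derive.
    - repeat split; [eexists; apply HG' | exact Ht].
    - replace (Derive (fun x => G x) t) with (n * k * hcos eta (n * t))
        by (symmetry; apply is_derive_unique, HG').
      unfold Rdiv; field; split; [lra | exact Hn0]. }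
  set (q := fun t => (n + 1) * R_ t / (lambda * G t)).
  (* [h] is the arc parameter as a function of the angle. It is monotone in the direction given by
     the sign [theta] of [n + 1], and its inverse is [nu]. *)
  destruct (antiderivative_on_open_interval ja jb q t0 Ht0) as [h Hh].
  { intros t Ht; apply (ex_derive_continuous q).
    assert (HGt := proj1 (HJ t) Ht); change (0 < G t) in HGt.
    unfold q; auto_derive; repeat split.
    - eexists; apply HR', Ht.
    - eexists; apply HG'.
    - apply Rmult_integral_contrapositive_currified; lra. }
  destruct (is_sign_of_nonzero (n + 1)) as [theta [Htheta Hthetapos]]; [lra |].
  destruct (inverse_of_monotone ja jb h q theta Htheta Hh) as [a [b [nu [Hh1 Hnu]]]].
  { intros t Ht; apply HJ in Ht; change (0 < G t) in Ht; unfold q.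
    replace (theta * ((n + 1) * R_ t / (lambda * G t)))
      with ((theta * (n + 1)) * R_ t / (lambda * G t)) by (field; split; lra).
    apply Rdiv_lt_0_compat; apply Rmult_lt_0_compat; auto. }
  set (rho := fun s => R_ (nu s)).
  set (gamma := fun s => pseudopolar f tau (rho s) (nu s)).
  assert (HG0 : forall s, in_open_interval a b s -> 0 < G (nu s)).
  { intros s Hs; apply HJ, (Hnu s Hs). }
  assert (Hpow : forall s, in_open_interval a b s -> Rpower (rho s) n = G (nu s)).
  { intros s Hs; apply HRn, (Hnu s Hs). }
  assert (Hnu' : forall s, in_open_interval a b s ->
            is_derive nu s (lambda / (n + 1) * G (nu s) / rho s)).
  { intros s Hs; destruct (Hnu s Hs) as [_ [_ H]]; assert (HGs := HG0 s Hs).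
    assert (Hr := HR0 (nu s)).
    replace (lambda / (n + 1) * G (nu s) / rho s) with (/ q (nu s)); [exact H |].
    unfold q, rho; field; repeat split; lra. }
  (* By the chain rule [G] and [rho] cancel, and [lambda / (n + 1) * k = sigma]. *)
  assert (Hrho' : forall s, in_open_interval a b s ->
            is_derive rho s (sigma * hcos eta (n * nu s))).
  { intros s Hs; assert (HGs := HG0 s Hs); assert (Hr := HR0 (nu s)).
    replace (sigma * hcos eta (n * nu s))
      with (lambda / (n + 1) * G (nu s) / rho s
            * (R_ (nu s) * k * hcos eta (n * nu s) / G (nu s))).
    - apply (is_derive_comp R_ nu); [apply HR', (Hnu s Hs) | apply Hnu', Hs].
    - unfold rho; transitivity (lambda / (n + 1) * k * hcos eta (n * nu s));
        [field; repeat split; lra |].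
      unfold k; field; split; lra. }
  assert (Hpp : pseudopolar_coordinates f tau a b gamma rho nu).
  { intros s Hs; split; [apply HR0 | reflexivity]. }
  assert (HlG : forall s, lambda / (n + 1) * G (nu s) = sigma * hsin eta (n * nu s)).
  { intros s; unfold G, k; field; split; lra. }
  assert (Heps : epsilon c = eta * form_sign f).
  { rewrite Heta; transitivity (epsilon c * (form_sign f * form_sign f));
      [rewrite Hd2; ring | ring]. }
  (* The addition formulas merge the angles [n nu] and [nu], and their signs multiply to
     [epsilon c]: the velocity is a signed hyperbolic unit vector of angle [(n + 1) nu]. *)
  assert (Hvel : forall s, in_open_interval a b s ->
     is_derive (fun t => fst (gamma t)) s
       (tau * sigma * hsin (epsilon c) ((n + 1) * nu s)) /\
     is_derive (fun t => snd (gamma t)) s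
       (tau * sigma * hcos (epsilon c) ((n + 1) * nu s))).
  { intros s Hs; assert (Hr := HR0 (nu s)).
    destruct (is_derive_pseudopolar f tau a b gamma rho nu s _ _ Hpp Hs
                (Hrho' s Hs) (Hnu' s Hs)) as [HX HY].
    assert (Hrn : rho s * (lambda / (n + 1) * G (nu s) / rho s)
                  = sigma * hsin eta (n * nu s)).
    { rewrite <- HlG; unfold rho; field; split; lra. }
    rewrite Hrn in HX, HY.
    replace ((n + 1) * nu s) with (n * nu s + nu s) by ring.
    rewrite Heps, hsin_plus, hcos_plus; split.
    - replace (tau * sigma * _) with
        (tau * (sigma * hcos eta (n * nu s) * hsin (form_sign f) (nu s) +
                sigma * hsin eta (n * nu s) * hcos (form_sign f) (nu s))) by ring.
      exact HX.
    - replace (tau * sigma * _) with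
        (tau * (sigma * hcos eta (n * nu s) * hcos (form_sign f) (nu s) +
                sigma * hsin eta (n * nu s) * hsin (form_sign f) (nu s))) by ring.
      exact HY. }
  assert (HX : forall s, in_open_interval a b s ->
     fst (velocity gamma s) = tau * sigma * hsin (epsilon c) ((n + 1) * nu s)).
  { intros s Hs; apply is_derive_unique, (Hvel s Hs). }
  assert (HY : forall s, in_open_interval a b s ->
     snd (velocity gamma s) = tau * sigma * hcos (epsilon c) ((n + 1) * nu s)).
  { intros s Hs; apply is_derive_unique, (Hvel s Hs). }
  assert (Hacc : forall s, in_open_interval a b s ->
     is_derive (fun t => fst (velocity gamma t)) s
       (tau * sigma * (lambda * G (nu s) / rho s
                       * hcos (epsilon c) ((n + 1) * nu s))) /\
     is_derive (fun t => snd (velocity gamma t)) s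
       (tau * sigma * (lambda * G (nu s) / rho s
                       * hsin (epsilon c) ((n + 1) * nu s)))).
  { intros s Hs; assert (Hr := HR0 (nu s)).
    (* The rate of change of the velocity's angle, which is the curvature [lambda rho^(n-1)]. *)
    assert (Hlin : is_derive (fun t => (n + 1) * nu t) s (lambda * G (nu s) / rho s)).
    { replace (lambda * G (nu s) / rho s)
        with ((n + 1) * (lambda / (n + 1) * G (nu s) / rho s))
        by (unfold rho; field; split; lra).
      apply (is_derive_scal nu), Hnu', Hs. }
    split.
    - apply is_derive_ext_loc with
        (fun t => tau * sigma * hsin (epsilon c) ((n + 1) * nu t)).
      + apply filter_imp with (2 := open_interval_locally a b s Hs).
        intros t Ht; symmetry; apply HX, Ht.
      + apply (is_derive_scal (fun t => hsin (epsilon c) ((n + 1) * nu t))).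
        apply (is_derive_comp (hsin (epsilon c)) (fun t => (n + 1) * nu t));
          [apply is_derive_hsin | exact Hlin].
    - apply is_derive_ext_loc with
        (fun t => tau * sigma * hcos (epsilon c) ((n + 1) * nu t)).
      + apply filter_imp with (2 := open_interval_locally a b s Hs).
        intros t Ht; symmetry; apply HY, Ht.
      + apply (is_derive_scal (fun t => hcos (epsilon c) ((n + 1) * nu t))).
        apply (is_derive_comp (hcos (epsilon c)) (fun t => (n + 1) * nu t));
          [apply is_derive_hcos | exact Hlin]. }
  exists a, b, gamma, rho, nu.
  split; [| split; [exact Hpp | split; [| split]]].
  - intros s Hs; split; [| split].
    + split; eexists; [apply (Hvel s Hs) | apply (Hacc s Hs)].
    + split; eexists; [apply (Hvel s Hs) | apply (Hacc s Hs)].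
    + unfold lorentz; rewrite (HX s Hs), (HY s Hs).
      transitivity (tau * tau * (sigma * sigma) *
        (hcos (epsilon c) ((n + 1) * nu s) ^ 2
         - hsin (epsilon c) ((n + 1) * nu s) ^ 2)); [ring |].
      rewrite Htau2, Hsigma2, hcos_sqr_sub_hsin_sqr; ring.
  - intros s Hs; assert (Hr := HR0 (nu s)); change (0 < rho s) in Hr; split.
    + unfold angular_momentum.
      rewrite (is_derive_unique _ _ _ (Hnu' s Hs)).
      rewrite Rpower_plus_1, Hpow by assumption; field; split; lra.
    + rewrite Rpower_minus_1, Hpow by assumption.
      destruct (Hacc s Hs) as [HX' HY'].
      assert (EX : fst (velocity (velocity gamma) s) = _)
        by exact (is_derive_unique _ _ _ HX').
      assert (EY : snd (velocity (velocity gamma) s) = _)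
        by exact (is_derive_unique _ _ _ HY').
      unfold curvature; cbv zeta; rewrite EX, EY.
      rewrite (HX s Hs), (HY s Hs).
      transitivity (epsilon c * (tau * tau) * (sigma * sigma)
        * (lambda * G (nu s) / rho s) *
        (hcos (epsilon c) ((n + 1) * nu s) ^ 2
         - hsin (epsilon c) ((n + 1) * nu s) ^ 2)); [ring |].
      rewrite Htau2, Hsigma2, hcos_sqr_sub_hsin_sqr.
      transitivity (epsilon c * epsilon c * (lambda * G (nu s) / rho s)); [ring |].
      rewrite Heps2; field; lra.
  - split; [exact Hsigma |]; destruct (kind_of c f); [| auto].
    intros s Hs; rewrite (is_derive_unique _ _ _ (Hrho' s Hs)), <- Rmult_assoc, Hsigma2.
    unfold hcos; simpl in eta; unfold eta.
    assert (H1 := exp_pos (n * nu s)); assert (H2 := exp_pos (- (n * nu s))); lra.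
  - intros p; split.
    + intros [r [t [Hr [Hp Heq]]]].
      apply spiral_equation_hsin in Heq; fold eta in Heq.
      (* A point of the spiral with angle [t] has [G t = r^n > 0], so [t] is admissible, [R_ t = r],
         and the curve passes through the point at parameter [h t]. *)
      assert (Hrn : Rpower r n = G t).
      { apply Rmult_eq_reg_l with (sigma * lambda);
          [| apply Rmult_integral_contrapositive_currified; lra].
        rewrite Heq; unfold G, k.
        transitivity (sigma * sigma * (n + 1) * hsin eta (n * t));
          [rewrite Hsigma2; ring | field; lra]. }
      assert (Ht : in_open_interval ja jb t).
      { apply HJ; fold (G t); rewrite <- Hrn; apply exp_pos. }
      assert (HRt : R_ t = r).
      { unfold R_; rewrite <- Hrn; unfold Rpower; rewrite ln_exp.
        replace (n * ln r / n) with (ln r) by (field; exact Hn0); apply exp_ln, Hr. }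
      destruct (Hh1 t Ht) as [Hht Hnuh].
      exists (h t); split; [exact Hht |].
      unfold gamma, rho; rewrite Hnuh, HRt; symmetry; exact Hp.
    + intros [s [Hs Hp]].
      exists (rho s), (nu s); split; [apply HR0 |]; split; [symmetry; exact Hp |].
      apply spiral_equation_hsin; fold eta; rewrite Hpow by exact Hs.
      unfold G, k; transitivity (sigma * sigma * (n + 1) * hsin eta (n * nu s));
        [field; lra | rewrite Hsigma2; ring].
Qed.

Theorem corollary5p1 (n lambda : R) (hn0 : n <> 0) (hn1 : n <> -1)
    (hlambda : 0 < lambda) (c : causal) (f : form) (tau : R) (htau : is_sign tau) :
  (* the spiral is a unit-speed curve with this momentum and curvature *)
  (forall sigma : R, is_sign sigma ->
     (kind_of c f = kind_minus -> 0 < sigma * (n + 1)) ->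
     exists (a b : Rbar) (gamma : R -> R * R) (rho nu : R -> R),
       unit_speed c a b gamma /\
       pseudopolar_coordinates f tau a b gamma rho nu /\
       has_momentum_and_curvature c lambda n a b gamma rho nu /\
       spiral_sign (kind_of c f) n a b rho sigma /\
       (forall p : R * R,
          spiral c f tau (sigma * lambda) n p <->
          exists s, in_open_interval a b s /\ gamma s = p)) /\
  (* every such curve is, up to a boost, on the spiral *)
  (forall (a b : Rbar) (gamma : R -> R * R) (rho nu : R -> R),
     unit_speed c a b gamma ->
     pseudopolar_coordinates f tau a b gamma rho nu ->
     has_momentum_and_curvature c lambda n a b gamma rho nu ->
     exists sigma nu0 : R,
       spiral_sign (kind_of c f) n a b rho sigma /\
       forall s, in_open_interval a b s ->
         spiral c f tau (sigma * lambda) n (boost nu0 (gamma s))).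
Proof.
  split.
  - intros sigma Hsigma Hminus; apply spiral_unit_speed_curve; assumption.
  - intros a b gamma rho nu Hus Hpp Hmk.
    apply (curve_on_spiral n lambda c f tau a b gamma rho nu); assumption.
Qed.
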